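(* Let $H$ be a real Hilbert space. Assume: - $\Psi:H\to\mathbb R\cup\{+\infty\}$ is a closed convex proper function such that $\inf_H\Psi=0$ and $C=\mathrm{argmin}\,\Psi\neq\emptyset$; - $\Phi:H\to\mathbb R\cup\{+\infty\}$ is a closed convex proper function such that $\inf_C\Phi=0$ and $\mathrm{argmin}_C\Phi\neq\emptyset$. Assume that the set $\mathrm{argmin}_C\Phi$ is bounded, and that for every $R>0$ and $l\in\mathbb R$ the set $\{x\in H:\ \|x\|\le R,\ \Psi(x)+\Phi(x)\le l\}$ is relatively compact in $H$. Let $\beta:[0,+\infty[\to[0,+\infty[$ be a map such that $\lim_{t\to+\infty}\beta(t)=+\infty$. Let $x(\cdot)$ be a strong global solution of $$\dot x(t)+\partial\Phi(x(t))+\beta(t)\,\partial\Psi(x(t))\ni0 .$$ Then: (i) $\lim_{t\to+\infty}d(x(t),\mathrm{argmin}_C\Phi)=0$. In particular, if $\mathrm{argmin}_C\Phi$ is a singleton $\{\overline x\}$ for some $\overline x\in H$, then $x(t)\to\overline x$ strongly in $H$ as $t\to+\infty$. (ii) If additionally $$\int_0^{+\infty}\beta(t)\,\bigl|\omega(1/\beta(t))\bigr|\,dt<+\infty,$$ where $\omega(\varepsilon)=\inf_H(\Psi+\varepsilon\Phi)$ for $\varepsilon\ge0$, then there exists $x_\infty\in\mathrm{argmin}_C\Phi$ such that $x(t)\rightharpoonup x_\infty$ weakly in $H$ as $t\to+\infty$.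
   Context: $H$ is a real Hilbert space with scalar product $\langle\cdot,\cdot\rangle$ and norm $\|\cdot\|$; $d(x,S)=\inf_{z\in S}\|x-z\|$. ''Closed'' means lower semicontinuous; proper means not identically $+\infty$. $\mathrm{argmin}_C\Phi$ is the set of minimizers of $\Phi$ over $C$. The subdifferential is $\partial f(x)=\{p\in H: f(y)\ge f(x)+\langle p,y-x\rangle\ \forall y\in H\}$ for $x$ with $f(x)<+\infty$ (empty otherwise). The function $\omega$ takes values in $\mathbb R\cup\{-\infty\}$. A strong global solution is a function $x:[0,+\infty[\to H$, absolutely continuous on every bounded interval $[0,T]$, satisfying the inclusion for almost every $t>0$. *)

(* Defs.v *)
From HB Require Import structures.
From mathcomp Require Import all_boot all_order all_algebra.
From mathcomp Require Import sesquilinear.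
From mathcomp Require Import all_classical all_reals all_analysis.
Import Order.TTheory GRing.Theory Num.Theory.
Import numFieldNormedType.Exports.

Set Implicit Arguments.
Unset Strict Implicit.
Unset Printing Implicit Defensive.

Local Open Scope classical_set_scope.
Local Open Scope ring_scope.

(** Functions with values in [R \cup {+oo}] are maps into [\bar R] that never
    take the value [-oo]. In [\bar R], [0 * +oo = 0]; at the end points
    [s = 0] and [s = 1] the convexity inequality is therefore trivial. *)

Section ConvexAnalysis.
Context {R : realType} {H : normedModType R}.
Implicit Types (f : H -> \bar R) (C : set H).

Definition econvex f : Prop :=
  forall (u v : H) (s : R), 0 <= s -> s <= 1 ->
    (f ((s *: u + (1 - s) *: v)%R) <= s%:E * f u + (1 - s)%:E * f v)%E.

Definition closed_convex_proper f : Prop :=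
  [/\ forall u, f u != -oo%E, exists u, f u != +oo%E,
      econvex f & lower_semicontinuous f].

Definition argmin C f : set H :=
  [set u | C u /\ forall v, C v -> (f u <= f v)%E].

Definition subdifferential (dot : H -> H -> R) f (u : H) : set H :=
  [set p | (f u < +oo)%E /\
           forall v, (f u + (dot p (v - u))%:E <= f v)%E].

(** Used for nonempty [S] only: [inf set0 = 0] for the real-valued [inf]. *)
Definition dist_set (u : H) (S : set H) : R :=
  inf [set `|u - z| | z in S].

(** The value at [e = 0] is [inf Psi], since [0 * +oo = 0]. *)
Definition omega (Psi Phi : H -> \bar R) (e : R) : \bar R :=
  ereal_inf [set (Psi z + e%:E * Phi z)%E | z in setT].

(** [x(t) -> u] weakly as [t -> +oo], the dual of [H] being identified with
    [H] through the scalar product. *)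
Definition weakly_cvg_pinfty (dot : H -> H -> R) (x : R -> H) (u : H) : Prop :=
  forall v, dot (x t) v @[t --> +oo] --> dot u v.

Definition absolutely_continuous_on (a b : R) (x : R -> H) : Prop :=
  forall e : R, 0 < e -> exists2 d : R, 0 < d &
    forall (n : nat) (l r : 'I_n -> R),
      (forall i, a <= l i /\ l i <= r i /\ r i <= b) ->
      trivIset setT (fun i => `]l i, r i[%classic) ->
      \sum_(i < n) (r i - l i) < d ->
      \sum_(i < n) `|x (r i) - x (l i)| < e.

(** [x'(t) + dPhi(x(t)) + beta(t) dPsi(x(t)) \ni 0] for almost every [t > 0];
    the values of [x] and [beta] at negative times play no role. *)
Definition strong_global_solution (dot : H -> H -> R) (Phi Psi : H -> \bar R)
    (beta : R -> R) (x : R -> H) : Prop :=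
  (forall T : R, 0 <= T -> absolutely_continuous_on 0 T x) /\
  {ae lebesgue_measure, forall t : R, 0 < t ->
     derivable x t 1 /\
     exists p q : H,
       [/\ subdifferential dot Phi (x t) p, subdifferential dot Psi (x t) q &
           derive1 x t + p + beta t *: q = 0]}.

End ConvexAnalysis.

(* Main.v *)
Require Import Defs.
From HB Require Import structures.
From mathcomp Require Import all_boot all_order all_algebra.
From mathcomp Require Import sesquilinear ring lra.
From mathcomp Require Import all_classical all_reals all_analysis.
From mathcomp Require Import measurable_realfun.
Import Order.TTheory GRing.Theory Num.Theory.
Import numFieldNormedType.Exports.

(** Write [S] for the set of minimizers of [Phi] over [argmin Psi]; both
    functions vanish on [S], and [S] is the set where both are nonpositive.

    For [z] in [S], the two subgradient inequalities at [x t] show that the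
    energy [`|x t - z| ^+ 2 / 2] has derivative at most
    [- (Phi (x t) + beta t * Psi (x t))] for almost every [t]
    ([subgradient_dissipation]). Everything is read off this inequality. To
    integrate it, one needs that an absolutely continuous function whose
    derivative is almost everywhere nonpositive is nonincreasing
    ([upper_absolutely_continuous_nonincreasing]). Here this is proved with
    gauges instead of covering lemmas: the null set of bad points sits in an
    open set of small measure, the slope is controlled near each good point,
    and a supremum argument glues the local estimates.

    Distance to [S]. For every [e > 0] there are [eta > 0] and [B] such that
    [Phi u + b * Psi u >= eta] as soon as [b >= B] and [u] is at distance at
    least [e] from [S] ([penalized_gap]). On the sphere of points at distance
    exactly [e] this follows by compactness, since a cluster point of a
    violating sequence would lie in [S]; convexity carries the bound outwards
    along segments issued from a point of [S]. Hence the energies decrease at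
    rate [eta] while the trajectory is farther than [e] from [S]. So the
    trajectory must come [e]-close to [S], and cannot afterwards go away by
    more than [2 * e] ([dist_set_trajectory_eventually_lt]).

    Convergence. The energy inequality also bounds the derivative of the
    energies by [beta t * `|omega (beta t)^-1|], whose integral is finite, so
    the total increase of an energy after time [T] tends to [0] as [T] grows
    ([eventually_small_increase]). The set [S] is compact, being bounded,
    closed and contained in a sublevel set of [Psi + Phi], and the distance
    from [x t] to [S] vanishes; so [x] has a cluster point [z] in [S] for the
    norm ([trajectory_cluster_point]). The energy at [z] is then small at some
    late times and cannot grow afterwards: [x t] tends to [z] in norm
    ([trajectory_cvg]), and a fortiori weakly. *)

Set Implicit Arguments.
Unset Strict Implicit.
Unset Printing Implicit Defensive.

Local Open Scope classical_set_scope.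
Local Open Scope ring_scope.

(** * Absolutely continuous functions with nonpositive derivative *)

(** Only the signed increments are controlled, from above. Thus subtracting a
    nondecreasing function preserves the property, whether or not that
    function is itself absolutely continuous. *)
Definition upper_absolutely_continuous (R : realType) (a b : R) (k : R -> R)
    : Prop :=
  forall e : R, 0 < e -> exists2 d : R, 0 < d &
    forall (n : nat) (l r : 'I_n -> R),
      (forall i, a <= l i /\ l i <= r i /\ r i <= b) ->
      trivIset setT (fun i => `]l i, r i[%classic) ->
      \sum_(i < n) (r i - l i) < d ->
      \sum_(i < n) (k (r i) - k (l i)) < e.

Lemma sum_length_le_measure (R : realType) (n : nat) (l r : 'I_n -> R)
    (U : set R) :
  measurable U -> (forall i, l i <= r i) ->
  trivIset setT (fun i => `]l i, r i[%classic) ->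
  (forall i, `]l i, r i[ `<=` U) ->
  ((\sum_(i < n) (r i - l i))%:E <= lebesgue_measure U)%E.
Proof.
move=> mU lr tri sub.
have mI (i : 'I_n) : measurable `]l i, r i[%classic by [].
have -> : (\sum_(i < n) (r i - l i))%:E =
    lebesgue_measure (\big[setU/set0]_(i < n) `]l i, r i[%classic).
  rewrite measure_bigsetU_ord// -sumEFin; apply: eq_bigr => i _.
  rewrite [RHS](lebesgue_measure_itv `]l i, r i[)/= lte_fin.
  have := lr i; rewrite le_eqVlt => /orP[/eqP ->|->]; last by rewrite EFinB.
  by rewrite ltxx subrr.
apply: le_measure; rewrite ?inE//.
  by apply: bigsetU_measurable.
by apply: (big_ind (fun A => A `<=` U)) => // A B AU BU t [/AU|/BU].
Qed.

(** The intervals are required to contain [t], not to end at [t]: this is what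
    lets the estimate be used with [t] the supremum of the times reached so
    far, from a time before [t] to a time after it. *)
Lemma derivable_straddle (R : realType) (k : R -> R) (t e : R) :
  derivable k t 1 -> derive1 k t <= 0 -> 0 < e ->
  exists2 d : R, 0 < d & forall u v, t - d < u -> u <= t -> t <= v -> v < t + d ->
    k v - k u <= e * (v - u).
Proof.
move=> dk k0 e0.
have [d /= d0 Hd] : exists2 d : R, 0 < d & forall h, `|h| < d -> h != 0 ->
    h^-1 * (k (h + t) - k t) <= e.
  have /cvgrPdist_le/(_ e e0)/nbhs_ballP[d /= d0 Hd] :
    h^-1 *: ((k \o shift t) (h *: (1 : R)) - k t) @[h --> 0^'] --> derive1 k t.
    by rewrite derive1E; exact: dk.
  exists d => // h hd h0; have /= := Hd h _ h0.
  rewrite /ball/= sub0r normrN => /(_ hd); rewrite /GRing.scale/= mulr1.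
  by rewrite distrC => /ler_normlP[_]; move: k0; lra.
exists d => // u v tu ut tv vt.
have right_incr : k v - k t <= e * (v - t).
  have [->|vNt] := eqVneq v t; first by lra.
  have vt0 : 0 < v - t by rewrite subr_gt0 lt_neqAle eq_sym vNt.
  have := Hd (v - t); rewrite gtr0_norm// lt0r_neq0// subrK => /(_ _ isT).
  by rewrite ler_pdivrMl// mulrC; apply; lra.
have left_incr : k t - k u <= e * (t - u).
  have [->|uNt] := eqVneq u t; first by lra.
  have ut0 : 0 < t - u by rewrite subr_gt0 lt_neqAle uNt.
  have := Hd (u - t); rewrite distrC gtr0_norm// subr_eq0 uNt subrK => /(_ _ isT).
  by rewrite -(opprB t u) invrN -(opprB (k t)) mulrNN ler_pdivrMl// mulrC; apply; lra.
lra.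
Qed.

Section gauge_argument.
Variables (R : realType) (a b e : R) (k : R -> R) (U : set R).

(** The invariant carried from [a] to [b]. The exceptional intervals are those
    crossed around points where the derivative is not controlled; being
    consecutive, they are disjoint, as absolute continuity requires. *)
Definition slope_le_off (t : R) : Prop :=
  exists (n : nat) (l r : nat -> R),
    [/\ forall i, (i < n)%N ->
          [/\ a <= l i, l i <= r i, r i <= t & `]l i, r i[ `<=` U],
        forall i j, (i < j)%N -> (j < n)%N -> r i <= l j &
        k t - k a <= e * (t - a) + \sum_(i < n) (k (r i) - k (l i))].

Lemma slope_le_off_start : slope_le_off a.
Proof.
exists 0%N, (fun=> 0), (fun=> 0); split=> //.
by rewrite big_ord0 !subrr mulr0 addr0.
Qed.

Lemma slope_le_off_slope u v : u <= v -> k v - k u <= e * (v - u) ->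
  slope_le_off u -> slope_le_off v.
Proof.
move=> uv kuv [n [l [r [lr dis le]]]]; exists n, l, r; split=> //.
- by move=> i /lr[? ? ? ?]; split=> //; exact: le_trans uv.
- by lra.
Qed.

Lemma slope_le_off_interval u v : 0 <= e -> a <= u -> u <= v -> `]u, v[ `<=` U ->
  slope_le_off u -> slope_le_off v.
Proof.
move=> e0 au uv uvU [n [l [r [lr dis le]]]].
exists n.+1, (fun i => if (i < n)%N then l i else u),
  (fun i => if (i < n)%N then r i else v); split.
- move=> i; rewrite ltnS => lein; case: ifPn => [/lr[? ? ? ?]|_] //.
  by split=> //; exact: le_trans uv.
- move=> i j ij; rewrite ltnS => jn; rewrite (leq_trans ij jn).
  by case: ifPn => [|_]; [exact: dis|have [] := lr i (leq_trans ij jn)].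
- rewrite big_ord_recr/= ltnn.
  under eq_bigr do rewrite ltn_ord.
  have : e * (u - a) <= e * (v - a) by apply: ler_wpM2l => //; lra.
  by lra.
Qed.

(** Real induction: the times satisfying [slope_le_off] have a supremum, and a
    gauge interval around the supremum reaches beyond it unless it is [b]. *)
Lemma slope_le_off_end : a <= b ->
  (forall t, a <= t -> t <= b -> exists2 d : R, 0 < d &
     forall u v, t - d < u -> u <= t -> t <= v -> v < t + d ->
       a <= u -> v <= b -> slope_le_off u -> slope_le_off v) ->
  slope_le_off b.
Proof.
move=> ab ext.
pose A := [set t | [/\ a <= t, t <= b & slope_le_off t]].
have Aa : A a by split=> //; exact: slope_le_off_start.
have Ab : ubound A b by move=> t [].
have hA : has_sup A by split; [exists a|exists b].
have as_ : a <= sup A by apply: ub_le_sup => //; exists b.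
have sb : sup A <= b by apply: ge_sup => //; exists a.
have [d d0 step] := ext _ as_ sb.
have [u [au ub su] sdu] := sup_adherent d0 hA.
have us : u <= sup A by apply: ub_le_sup; [exists b|split].
have [bd|db] := ltP b (sup A + d); first exact: step su.
have vb : sup A + d / 2 <= b by lra.
suff /(ub_le_sup (ex_intro (ubound A) b Ab)) : A (sup A + d / 2) by lra.
by split=> //; [lra|apply: step su => //; lra].
Qed.

End gauge_argument.

(** Given [e], upper absolute continuity yields [d]; the points of bad
    derivative are covered by an open set [U] of measure less than [d], so the
    exceptional intervals of [slope_le_off] contribute at most [e] in all. *)
Lemma upper_absolutely_continuous_nonincreasing (R : realType) (a b : R)
    (k : R -> R) : a <= b -> upper_absolutely_continuous a b k ->
  {ae lebesgue_measure, forall t : R, a < t -> t < b ->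
     derivable k t 1 /\ derive1 k t <= 0} ->
  k b <= k a.
Proof.
move=> ab ack [N' [mN' N'0 badN]].
suff H e : 0 < e -> k b - k a <= e * (b - a) + e.
  rewrite -subr_le0; apply/ler_addgt0Pr => e e0; rewrite add0r.
  have e1 : 0 < e / (b - a + 1) by apply: divr_gt0 => //; lra.
  have := H _ e1.
  have : e / (b - a + 1) * (b - a + 1) = e by rewrite divfK// lt0r_neq0//; lra.
  by lra.
move=> e0; have [d d0 small] := ack _ e0.
(* The end points are put in the exceptional set, because the derivative is only
   controlled on the open interval. *)
pose N := (N' `|` [set a; b]) : set R.
have mN : measurable N by apply: measurableU => //; exact: measurableU.
have N0 : lebesgue_measure N = 0%E.
  apply/negligibleP => //; apply: negligibleU.
    by exists N'; split; [exact: mN'|exact: N'0|].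
  by apply: negligibleU; [exists [set a]|exists [set b]]; split=> //;
    exact: lebesgue_measure_set1.
have [U [oU NU muU]] : exists U : set R, [/\ open U, N `<=` U &
    (lebesgue_measure U < d%:E)%E].
  have [|U [oU NU UN]] := lebesgue_regularity_outer mN _ d0; first by rewrite [ltLHS]N0.
  exists U; split=> //.
  rewrite -(setDKU NU); apply: le_lt_trans (measureU2 _ _ _) _ => //.
    by apply: measurableD => //; exact: open_measurable.
  by rewrite [X in (_ + X)%E]N0 adde0.
have [n [l [r [lr dis le]]]] : slope_le_off a e k U b.
  apply: slope_le_off_end => // t at_ tb.
  have [Nt|nNt] := pselect (N t).
    have /nbhs_ballP[c /= c0 cU] : nbhs t U by apply: open_nbhs_nbhs; split=> //; exact: NU.
    exists c => // u v cu ut tv vc au vb; apply: slope_le_off_interval => //.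
    - exact: ltW.
    - exact: le_trans tv.
    - move=> w/=; rewrite in_itv/= => /andP[uw wv]; apply: cU.
      by rewrite /ball/=; apply/ltr_normlP; split; lra.
  have ltat : a < t.
    by rewrite lt_neqAle at_ andbT; apply/eqP => E; apply: nNt; right; left.
  have lttb : t < b.
    by rewrite lt_neqAle tb andbT; apply/eqP => E; apply: nNt; right; right.
  have [dk k0] : derivable k t 1 /\ derive1 k t <= 0.
    by apply: contrapT => nP; apply: nNt; left; apply: badN => /(_ ltat lttb).
  have [c c0 cP] := derivable_straddle dk k0 e0.
  exists c => // u v cu ut tv vc au vb; apply: slope_le_off_slope.
  - exact: le_trans tv.
  - exact: cP.
have tri : trivIset setT (fun i : 'I_n => `](l \o val) i, (r \o val) i[%classic).
  move=> i j _ _ [w []]; rewrite /= !in_itv/= => /andP[lw wr] /andP[l'w wr'].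
  apply/val_inj/eqP/contraT; rewrite neq_ltn.
  by move=> /orP[/dis/(_ (ltn_ord j))|/dis/(_ (ltn_ord i))]; lra.
apply: (le_trans le); rewrite lerD2l ltW//.
apply: (small n (l \o val) (r \o val)) => // [i|].
- by have [? ? ? ?] := lr _ (ltn_ord i).
- rewrite -lte_fin; apply: le_lt_trans muU.
  apply: (@sum_length_le_measure _ n (l \o val) (r \o val)).
  + exact: open_measurable.
  + by move=> i; have [] := lr _ (ltn_ord i).
  + exact: tri.
  + by move=> i; have [] := lr _ (ltn_ord i).
Qed.

(** * The energy of a curve *)

Section inner_product.
Variables (R : realType) (H : normedModType R) (dot : {dot H for idfun}).
Hypothesis dot_norm : forall u : H, dot u u = `|u| ^+ 2.

Lemma dot_sym u v : dot u v = dot v u.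
Proof. by rewrite (hermC dot) /= expr0 mul1r. Qed.

Lemma dotDl u v w : dot (u + v) w = dot u w + dot v w.
Proof. exact: linearDl. Qed.

Lemma dotNl u w : dot (- u) w = - dot u w.
Proof. exact: linearNl. Qed.

Lemma dotBl u v w : dot (u - v) w = dot u w - dot v w.
Proof. by rewrite dotDl dotNl. Qed.

Lemma dotZl c u w : dot (c *: u) w = c * dot u w.
Proof. exact: linearZl_LR. Qed.

Lemma dotNr u w : dot w (- u) = - dot w u.
Proof. by rewrite dot_sym dotNl dot_sym. Qed.

Lemma sqr_normD u v : `|u + v| ^+ 2 = `|u| ^+ 2 + 2 * dot u v + `|v| ^+ 2.
Proof.
rewrite -!dot_norm dotDl ![dot _ (u + v)]dot_sym !dotDl (dot_sym v u); ring.
Qed.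

(** Cauchy-Schwarz, here a consequence of the triangle inequality for the norm
    applied to [w + v], squared. *)
Lemma norm_dot_le u v : `|dot u v| <= `|u| * `|v|.
Proof.
have dot_le w : dot w v <= `|w| * `|v|.
  have := sqr_normD w v; have := ler_normD w v.
  by have := normr_ge0 (w + v); nra.
by rewrite ler_norml dot_le andbT lerNl -dotNl -(normrN u) dot_le.
Qed.

Lemma cvg_dotl (T : Type) (F : set_system T) (FF : Filter F) (f : T -> H)
    (l v : H) :
  f t @[t --> F] --> l -> dot (f t) v @[t --> F] --> dot l v.
Proof.
move=> fl; apply/cvgrPdist_le => e e0.
have v1 : 0 < `|v| + 1 by rewrite ltr_wpDl.
have e1 : 0 < e / (`|v| + 1) by exact: divr_gt0.
move/cvgrPdist_le: fl => /(_ _ e1); apply: filterS => t le.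
rewrite -dotBl; apply: (le_trans (norm_dot_le _ _)).
rewrite -[leRHS](divfK (lt0r_neq0 v1)).
by apply: ler_pM => //; rewrite lerDl.
Qed.

Lemma derive_half_sqr_dist (x : R -> H) (z : H) (t : R) : derivable x t 1 ->
  derivable (fun s => `|x s - z| ^+ 2 / 2) t 1 /\
  derive1 (fun s => `|x s - z| ^+ 2 / 2) t = dot (derive1 x t) (x t - z).
Proof.
move=> dx; set g := fun s => _.
pose q h := h^-1 *: ((x \o shift t) (h *: (1 : R)) - x t).
have qx : q h @[h --> 0^'] --> derive1 x t by rewrite derive1E; exact: dx.
suff gq : h^-1 *: ((g \o shift t) (h *: (1 : R)) - g t) @[h --> 0^'] -->
    dot (derive1 x t) (x t - z).
  by split; [apply/cvg_ex; eexists; exact: gq|rewrite derive1E; exact/cvg_lim].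
have half_square_increment (c D N W : R) :
  c * ((N + 2 * D + W) / 2 - W / 2) = c * D + c * N / 2 by field.
(* The identity also holds at [h = 0], where both sides vanish. *)
have -> : (fun h => h^-1 *: ((g \o shift t) (h *: (1 : R)) - g t)) =
    (fun h => dot (q h) (x t - z) + h / 2 * (`|q h| * `|q h|)).
  apply/funext => h; rewrite /g /q /= -expr2 normrZ dotZl exprMn.
  set y := x _; have -> : y - z = (y - x t) + (x t - z) by rewrite addrA subrK.
  rewrite sqr_normD [X in _ = _ + X](_ : _ = h^-1 * `|y - x t| ^+ 2 / 2).
    exact: half_square_increment.
  have [->|h0] := eqVneq h 0; first by rewrite invr0 !mul0r.
  by rewrite normfV exprVn real_normK ?num_real//; field.
rewrite -[X in _ --> X]addr0; apply: cvgD; first exact: cvg_dotl.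
rewrite -[X in _ --> X](_ : 0 / 2 * (`|derive1 x t| * `|derive1 x t|) = 0); last by rewrite !mul0r.
apply: cvgM.
  apply: cvgMl; apply: cvg_within_filter; exact: cvg_id.
by apply: cvgM; exact: cvg_norm.
Qed.

End inner_product.

Section absolutely_continuous_curves.
Variables (R : realType) (H : normedModType R).
Implicit Types (x : R -> H) (a b : R).

Lemma absolutely_continuous_onS a b a' b' x : a <= a' -> b' <= b ->
  absolutely_continuous_on a b x -> absolutely_continuous_on a' b' x.
Proof.
move=> aa bb ac e /ac[d d0 small]; exists d => // n l r lr; apply: small => i.
by have [? [? ?]] := lr i; split; [exact: le_trans aa _|split=> //; exact: le_trans bb].
Qed.

Lemma absolutely_continuous_on_uniform a b x : absolutely_continuous_on a b x ->
  forall e, 0 < e -> exists2 d, 0 < d &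
    forall u v, a <= u -> u <= v -> v <= b -> v - u < d -> `|x v - x u| < e.
Proof.
move=> ac e /ac[d d0 small]; exists d => // u v au uv vb vud.
have := small 1%N (fun=> u) (fun=> v); rewrite !big_ord1; apply=> //.
by move=> i j _ _ _; rewrite !ord1.
Qed.

Lemma absolutely_continuous_on_continuous a b x t :
  absolutely_continuous_on a b x -> a < t -> t < b -> {for t, continuous x}.
Proof.
move=> /absolutely_continuous_on_uniform ac at_ tb; apply/cvgrPdist_lt => e /ac[d d0 small].
near=> s.
have as_ : a < s by near: s; exact: lt_nbhsr.
have sb : s < b by near: s; exact: lt_nbhsl.
have /ltr_normlP[st ts] : `|t - s| < d.
  by near: s; apply/nbhs_ballP; exists d.
have [ts'|st'] := leP t s.
  by rewrite distrC; apply: small; lra.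
by apply: small; lra.
Unshelve. all: by end_near. Qed.

Lemma absolutely_continuous_on_bounded a b x z : absolutely_continuous_on a b x ->
  exists2 M, 0 < M & forall t, a <= t -> t <= b -> `|x t - z| <= M.
Proof.
move=> /absolutely_continuous_on_uniform /(_ 1 ltr01)[d d0 small].
have bound (n : nat) t : a <= t -> t <= b -> t - a <= n%:R * (d / 2) ->
    `|x t - x a| <= n%:R.
  elim: n t => [|n IH] t at_ tb.
    by rewrite mul0r => ta; have -> : t = a; [lra|rewrite subrr normr0].
  rewrite -natr1 mulrDl mul1r => tan.
  have [ta|at'] := leP (t - a) (n%:R * (d / 2)).
    by apply: le_trans (IH _ at_ tb ta) _; rewrite lerDl.
  have n0 : 0 <= n%:R * (d / 2) by apply: mulr_ge0 => //; lra.
  pose s := a + n%:R * (d / 2).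
  rewrite -[x t](subrK (x s)) -addrA; apply: (le_trans (ler_normD _ _)).
  rewrite [leRHS]addrC; apply: lerD; last by apply: IH; rewrite /s; lra.
  by apply: ltW; apply: small; rewrite /s; lra.
have [n ltn] : exists n : nat, (b - a) / (d / 2) < n%:R.
  exists (Num.bound `|(b - a) / (d / 2)|).
  exact: le_lt_trans (ler_norm _) (archi_boundP (normr_ge0 _)).
have d2 : 0 < d / 2 by lra.
exists (n%:R + `|x a - z| + 1) => [|t at_ tb].
  by rewrite ltr_wpDl// addr_ge0.
rewrite -[x t](subrK (x a)) -addrA; apply: (le_trans (ler_normD _ _)).
apply: ler_wpDr => //; apply: lerD => //; apply: bound => //.
move: ltn; rewrite ltr_pdivrMr//; lra.
Qed.

(** The function [F] will be either the primitive of a nonnegative function,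
    with [c = 0], or linear and decreasing with slope [- c]: in both cases it
    decreases at most at rate [c], which is all that the upper estimate
    needs. *)
Lemma half_sqr_dist_upper_absolutely_continuous a b x z (F : R -> R) c :
  absolutely_continuous_on a b x -> 0 <= c ->
  (forall u v, a <= u -> u <= v -> v <= b -> F u - F v <= c * (v - u)) ->
  upper_absolutely_continuous a b (fun t => `|x t - z| ^+ 2 / 2 - F t).
Proof.
move=> ac c0 Fc e e0.
have [M M0 xM] := absolutely_continuous_on_bounded z ac.
have e2 : 0 < e / 2 / M by rewrite !divr_gt0.
have c1 : 0 < c + 1 by lra.
have [d d0 small] := ac _ e2.
exists (Num.min d (e / 2 / (c + 1))) => [|n l r lr tri].
  by rewrite lt_min d0 !divr_gt0.
rewrite lt_min => /andP[/(small _ _ _ lr tri) dx dt].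
have le_incr i : `|x (r i) - z| ^+ 2 / 2 - F (r i) - (`|x (l i) - z| ^+ 2 / 2 - F (l i)) <=
    M * `|x (r i) - x (l i)| + (c + 1) * (r i - l i).
  have [ali [lri rib]] := lr i.
  have := Fc _ _ ali lri rib.
  have := xM _ (le_trans ali lri) rib; have := xM _ ali (le_trans lri rib).
  have : `|x (r i) - z| - `|x (l i) - z| <= `|x (r i) - x (l i)|.
    by apply: le_trans (lerB_dist _ _) _; rewrite opprB addrA subrK.
  have := normr_ge0 (x (r i) - z); have := normr_ge0 (x (l i) - z).
  have := normr_ge0 (x (r i) - x (l i)).
  move: `|x (r i) - z| `|x (l i) - z| `|x (r i) - x (l i)| => p q w.
  move=> w0 q0 p0 pqw qM pM Fle.
  have : (p ^+ 2 - q ^+ 2) / 2 <= M * w.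
    have [pq|qp] := leP p q; first by have : 0 <= M * w; [rewrite mulr_ge0// ltW|nra].
    have : (p - q) * (p + q) <= w * (2 * M) by apply: ler_pM; lra.
    by nra.
  by nra.
apply: (le_lt_trans (ler_sum _ (fun i _ => le_incr i))).
rewrite big_split/= -!mulr_sumr [ltRHS](splitr e); apply: ltrD.
  by rewrite mulrC -ltr_pdivlMr.
by rewrite mulrC -ltr_pdivlMr.
Qed.

End absolutely_continuous_curves.

(** * Distance to a set and compactness *)

Section distance_to_a_set.
Variables (R : realType) (H : normedModType R) (S : set H).
Hypothesis S_neq0 : S !=set0.
Implicit Types (u v z : H).

Let norms_neq0 u : [set `|u - z| | z in S] !=set0.
Proof. by have [z Sz] := S_neq0; exists `|u - z|; exists z. Qed.

Let norms_lb u : lbound [set `|u - z| | z in S] 0.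
Proof. by move=> _ [z _ <-]. Qed.

Lemma dist_set_ge0 u : 0 <= dist_set u S.
Proof. exact: lb_le_inf. Qed.

Lemma dist_set_le u z : S z -> dist_set u S <= `|u - z|.
Proof. by move=> Sz; apply: ge_inf; [exists 0|exists z]. Qed.

Lemma dist_set_lt u e : dist_set u S < e -> exists2 z, S z & `|u - z| < e.
Proof.
by move=> /(inf_lt (norms_neq0 u))[_ [z Sz <-] ze]; exists z.
Qed.

Lemma dist_set_lipschitz u v : dist_set u S <= `|u - v| + dist_set v S.
Proof.
apply/ler_addgt0Pr => e e0.
have [z Sz vz] : exists2 z, S z & `|v - z| < dist_set v S + e.
  by apply: dist_set_lt; rewrite ltrDl.
apply: (le_trans (dist_set_le _ Sz)).
rewrite -[u](subrK v) -addrA; apply: (le_trans (ler_normD _ _)).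
by rewrite subrK -addrA lerD2l ltW.
Qed.

Lemma dist_set_continuous : continuous (fun u => dist_set u S).
Proof.
move=> u; apply/cvgrPdist_le => e e0.
near=> v.
have uv : `|u - v| <= e.
  near: v; apply/nbhs_ballP; exists e => //= v.
  by rewrite -ball_normE => /ltW.
have := dist_set_lipschitz u v; have := dist_set_lipschitz v u.
rewrite (distrC v u) => vu uv'; apply/ler_normlP; split; lra.
Unshelve. all: by end_near. Qed.

End distance_to_a_set.

Section compact_sublevels.
Variables (R : realType) (H : normedModType R).

Lemma precompact_sequence_cluster (K : set H) (v : nat -> H) :
  precompact K -> (forall n, K (v n)) ->
  exists p : H, forall V, nbhs p V -> forall N : nat, exists2 n, (N <= n)%N & V (v n).
Proof.
rewrite precompactE => cK Kv.
have [|p [_ vp]] := cK (v n @[n --> \oo]) _.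
  by exists 0%N => // n _; apply: subset_closure; exact: Kv.
exists p => V Vp N.
have [|_ [[n Nn <-] Vn]] := vp (v @` [set n | (N <= n)%N]) V _ Vp.
  by exists N => // n Nn; exists n.
by exists n.
Qed.

(** The neighborhood [V] makes the lemma usable when the bound on [f (v n)]
    relies on the semicontinuity of another function at [p]. *)
Lemma cluster_le_lsc (f : H -> \bar R) (v : nat -> H) (p : H) (c : R) :
  lower_semicontinuous f ->
  (forall V, nbhs p V -> forall N : nat, exists2 n, (N <= n)%N & V (v n)) ->
  (forall e : R, c < e -> exists2 V, nbhs p V & exists N, forall n, (N <= n)%N ->
     V (v n) -> (f (v n) <= e%:E)%E) ->
  (f p <= c%:E)%E.
Proof.
move=> lscf vp fv; rewrite leNgt; apply/negP => cf.
have [e ce ef] : exists2 e : R, c < e & (e%:E < f p)%E.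
  case: (f p) cf => [r||//]; last by exists (c + 1); rewrite ?ltry ?ltrDl.
  by rewrite lte_fin => cr; exists ((c + r) / 2); rewrite ?lte_fin; lra.
have [V Vp Vf] := lscf _ _ ef.
have [W Wp [N fN]] := fv _ ce.
have [n Nn [/Vf + Wn]] := vp _ (filterI Vp Wp) N.
by apply/negP; rewrite -leNgt fN.
Qed.

End compact_sublevels.

(** * Lower bound for the penalized function away from the minimizers *)

Lemma econvex_le_scale (R : realType) (H : normedModType R) (f : H -> \bar R)
    (u z : H) (r s : R) :
  econvex f -> f u = r%:E -> (f z <= 0)%E -> 0 <= s -> s <= 1 ->
  (f (s *: u + (1 - s) *: z)%R <= (s * r)%:E)%E.
Proof.
move=> cf fu fz s0 s1; apply: (le_trans (cf u z s s0 s1)).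
rewrite fu -EFinM -[leRHS]adde0 leeD2l// mule_ge0_le0// lee_fin; lra.
Qed.

(** The values [phi] and [psi] are introduced as real numbers, so that only
    points of the common effective domain are concerned. *)
Definition penalized_ge (R : realType) (H : normedModType R)
    (Phi Psi : H -> \bar R) (S : set H) (e eta B : R) : Prop :=
  forall (b : R) (u : H) (phi psi : R), B <= b ->
    Phi u = phi%:E -> Psi u = psi%:E -> e <= dist_set u S ->
    eta <= phi + b * psi.

Section penalization.
Variables (R : realType) (H : normedModType R) (Phi Psi : H -> \bar R).
Variable S : set H.
Hypotheses (convex_Phi : econvex Phi) (convex_Psi : econvex Psi).
Hypotheses (lsc_Phi : lower_semicontinuous Phi)
  (lsc_Psi : lower_semicontinuous Psi).
Hypotheses (Phi_proper : forall u, Phi u != -oo%E) (Psi_ge0 : forall u, (0 <= Psi u)%E).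
Hypothesis S_def : forall u, S u <-> (Psi u <= 0)%E /\ (Phi u <= 0)%E.
Hypotheses (S_neq0 : S !=set0) (S_bounded : bounded_set S).
Hypothesis sublevel_precompact : forall r l : R, 0 < r ->
  precompact [set z : H | `|z| <= r /\ (Psi z + Phi z <= l%:E)%E].

(** Otherwise there are points [v n] at distance [e] from [S] with
    [Phi (v n) + b * Psi (v n)] below [n.+1%:R^-1] for some [b] at least
    [n.+1%:R]. They lie in a sublevel set of [Psi + Phi], hence have a cluster
    point [p]. In the limit [Phi p <= 0]; as [Phi] is bounded below near [p],
    also [Psi p <= 0]. So [p] is in [S], although its distance to [S] is
    [e]. *)
Lemma penalized_gap_sphere e : 0 < e -> exists N : nat,
  forall (b : R) (v : H) (phi psi : R), N.+1%:R <= b ->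
    Phi v = phi%:E -> Psi v = psi%:E -> dist_set v S = e ->
    N.+1%:R^-1 <= phi + b * psi.
Proof.
move=> e0; apply: contrapT => /forallNP nP.
have {nP} /choice[w wP] : forall N : nat, exists w : (H * R) * (R * R),
    [/\ N.+1%:R <= w.1.2, Phi w.1.1 = w.2.1%:E, Psi w.1.1 = w.2.2%:E,
        dist_set w.1.1 S = e & w.2.1 + w.1.2 * w.2.2 < N.+1%:R^-1].
  move=> N; apply: contrapT => /forallNP nw; apply: (nP N) => b v phi psi *.
  by rewrite leNgt; apply/negP => ?; apply: (nw ((v, b), (phi, psi))).
pose v N := (w N).1.1.
have psi0 N : 0 <= (w N).2.2.
  by have [_ _ E _ _] := wP N; rewrite -lee_fin -E.
have le1 N : N.+1%:R^-1 <= 1 :> R by rewrite invf_le1// ler1n.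
have ge1 N : 1 <= N.+1%:R :> R by rewrite ler1n.
have [M [_ /(_ (`|M| + 1)) SM]] := S_bounded.
have vK N : [set z | `|z| <= `|M| + 1 + (e + 1) /\ (Psi z + Phi z <= 1%:E)%E] (v N).
  have [Nb EPhi EPsi de lt] := wP N; split.
    have [z Sz vz] : exists2 z, S z & `|v N - z| < e + 1.
      by apply: dist_set_lt => //; rewrite de ltrDl.
    rewrite -[v N](subrK z) addrC; apply: (le_trans (ler_normD _ _)).
    apply: lerD; last exact: ltW.
    by apply: SM => //; rewrite (le_lt_trans (ler_norm M))// ltrDl.
  rewrite EPhi EPsi -EFinD lee_fin.
  have : (w N).2.2 <= (w N).1.2 * (w N).2.2.
    by rewrite ler_peMl// (le_trans (ge1 N)).
  by have := lt_le_trans lt (le1 N); lra.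
have r0 : 0 < `|M| + 1 + (e + 1) by rewrite ltr_wpDl ?addr_ge0// addr_gt0.
have [p vp] := precompact_sequence_cluster (sublevel_precompact 1 r0) vK.
have Phip : (Phi p <= 0)%E.
  apply: (cluster_le_lsc lsc_Phi vp) => c c0; exists setT; first exact: filterT.
  exists (Num.bound c^-1) => n cn _.
  have [Nb -> EPsi de lt] := wP n; rewrite lee_fin.
  have : n.+1%:R^-1 <= c.
    rewrite invf_ple ?posrE//; apply: ltW; apply: lt_le_trans (archi_boundP _) _.
      by rewrite invr_ge0 ltW.
    by rewrite ler_nat (leq_trans cn).
  have : 0 <= (w n).1.2 * (w n).2.2 by rewrite mulr_ge0// (le_trans _ Nb).
  by move=> bpsi0 /(lt_le_trans lt); lra.
(* [Psi (v n)] is at most [(1 - m) / n.+1%:R] when [Phi (v n) > m]. *)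
have Psip : (Psi p <= 0)%E.
  have [m mPhi] : exists m : R, (m%:E < Phi p)%E.
    case: (Phi p) (Phi_proper p) => [r _|_|//]; last by exists 0; rewrite ltry.
    by exists (r - 1); rewrite lte_fin; lra.
  have [V Vp VPhi] := lsc_Phi mPhi.
  apply: (cluster_le_lsc lsc_Psi vp) => c c0; exists V => //.
  exists (Num.bound ((1 + `|m|) / c)) => n cn /VPhi.
  have [Nb -> -> de lt] := wP n; rewrite lte_fin lee_fin => mphi.
  have : (1 + `|m|) / c <= n.+1%:R.
    apply: ltW; apply: lt_le_trans (archi_boundP _) _.
      by rewrite divr_ge0 ?(ltW c0)// addr_ge0.
    by rewrite ler_nat (leq_trans cn).
  rewrite ler_pdivrMr// => mc; rewrite leNgt; apply/negP => cpsi.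
  have := ler_norm (- m); rewrite normrN.
  have := lt_le_trans lt (le1 n).
  have : n.+1%:R * c <= (w n).1.2 * (w n).2.2 by apply: ler_pM => //; lra.
  by lra.
have /ltr_normlP[] : `|dist_set p S - e| < e.
  have Vp : nbhs p [set u | `|dist_set p S - dist_set u S| < e].
    by have /cvgrPdist_lt/(_ e e0) := @dist_set_continuous _ _ _ S_neq0 p.
  have [n _ /=] := vp _ Vp 0%N.
  by have [_ _ _ -> _] := wP n.
have Sp : S p by apply/S_def.
by have := dist_set_le p Sp; rewrite subrr normr0; lra.
Qed.

(** The segment from a point [z] of [S] to [u] crosses the sphere of the
    previous lemma at some [s *: u + (1 - s) *: z]. By convexity the penalized
    function there is at most [s <= 1] times its value at [u]. *)
Lemma penalized_gap e : 0 < e -> exists eta B : R,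
  0 < eta /\ penalized_ge Phi Psi S e eta B.
Proof.
move=> e0; have [N gap] := penalized_gap_sphere e0.
exists N.+1%:R^-1, N.+1%:R; split; first by rewrite invr_gt0.
move=> b u phi psi Nb Phiu Psiu eu.
have [z Sz] := S_neq0.
have [Psiz Phiz] := (S_def z).1 Sz.
pose y (s : R) := s *: u + (1 - s) *: z.
have [s] : exists2 s, s \in `[0, 1] & dist_set (y s) S = e.
  apply: IVT => //.
    apply: continuous_subspaceT => s.
    apply: (continuous_comp _ (dist_set_continuous S_neq0 (x := _))).
    apply: cvgD; first by apply: cvgZl; exact: cvg_id.
    by apply: cvgZl; apply: cvgB; [exact: cvg_cst|exact: cvg_id].
  have -> : y 0 = z by rewrite /y scale0r add0r subr0 scale1r.
  have -> : y 1 = u by rewrite /y subrr scale0r addr0 scale1r.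
  have dz : dist_set z S <= 0 by rewrite -[leRHS](normr0 H) -(subrr z) dist_set_le.
  by rewrite ge_min le_max eu (le_trans dz (ltW e0)) orbT.
rewrite in_itv/= => /andP[s0 s1] dy.
have Phiy := econvex_le_scale convex_Phi Phiu Phiz s0 s1.
have Psiy := econvex_le_scale convex_Psi Psiu Psiz s0 s1.
have [phi' Phiy'] : exists phi', Phi (y s) = phi'%:E.
  by move: Phiy (Phi_proper (y s)); rewrite -/(y s); case: (Phi _) => // r; exists r.
have [psi' Psiy'] : exists psi', Psi (y s) = psi'%:E.
  by move: Psiy (Psi_ge0 (y s)); rewrite -/(y s); case: (Psi _) => // r; exists r.
have := gap b _ _ _ Nb Phiy' Psiy' dy.
move: Phiy Psiy; rewrite -!/(y s) Phiy' Psiy' !lee_fin.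
have : 0 < N.+1%:R^-1 :> R by rewrite invr_gt0.
have : 1 <= N.+1%:R :> R by rewrite ler1n.
move: (N.+1%:R) Nb (N.+1%:R^-1) => B Nb eta B1 eta0 Phiy Psiy le.
have b0 : 0 <= b by lra.
have le2 : eta <= s * (phi + b * psi) by nra.
have : 0 < phi + b * psi by apply: contraT; rewrite -leNgt => ?; nra.
by nra.
Qed.

End penalization.

(** * Functions whose derivative has an integrable majorant *)

(** The integral of a nonnegative function is a supremum over the simple
    functions below it, so monotonicity holds without measurability. This
    matters because [beta], hence the integrand built on [omega], is an
    arbitrary map. *)
Lemma ge0_le_integral_nonmeasurable d (T : measurableType d) (R : realType)
    (mu : {measure set T -> \bar R}) (D E : set T) (f g : T -> \bar R) :
  (forall t, D t -> (0 <= f t)%E) -> (forall t, E t -> (0 <= g t)%E) ->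
  (forall t, ((f \_ D) t <= (g \_ E) t)%E) ->
  (\int[mu]_(t in D) f t <= \int[mu]_(t in E) g t)%E.
Proof.
move=> f0 g0 fg; rewrite !ge0_integralE//.
apply: le_ereal_sup => _ [h hf <-]; exists h => // t.
exact: le_trans (fg t).
Qed.

Lemma derive1_limit_sequence (R : realType) (g : R -> R) (t : R) :
  derivable g t 1 ->
  n.+1%:R * (g (n.+1%:R^-1 + t) - g t) @[n --> \oo] --> derive1 g t.
Proof.
move=> dg.
have qg : h^-1 *: ((g \o shift t) (h *: (1 : R)) - g t) @[h --> 0^'] --> derive1 g t.
  by rewrite derive1E; exact: dg.
have h0 : n.+1%:R^-1 @[n --> \oo] --> (0 : R)^'.
  move=> A A0; change (\forall n \near \oo, A (n.+1%:R^-1)).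
  have := @cvg_harmonic R _ A0; rewrite nbhs_simpl/=.
  by apply: filterS => n; apply; rewrite /= invr_eq0.
have := cvg_comp _ _ h0 qg.
rewrite (_ : _ \o _ = (fun n => n.+1%:R * (g (n.+1%:R^-1 + t) - g t)))//.
by apply/funext => n; rewrite /= invrK /GRing.scale/= mulr1.
Qed.

Lemma measurable_derive1 (R : realType) (D : set R) (g : R -> R) :
  measurable D -> (forall t, D t -> 0 < t) ->
  (forall t, 0 < t -> {for t, continuous g}) ->
  (forall t, D t -> derivable g t 1) ->
  measurable_fun D (derive1 g : R -> R).
Proof.
move=> mD Dgt0 cg dg.
apply: (@measurable_fun_cvg _ _ R D
  (fun n t => n.+1%:R * (g (n.+1%:R^-1 + t) - g t))) => [n|t Dt]; last first.
  by apply: derive1_limit_sequence; exact: dg.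
suff mI : measurable_fun (`]0, +oo[%classic : set R)
    (fun t => n.+1%:R * (g (n.+1%:R^-1 + t) - g t)).
  apply: measurable_funS mI => //.
  by move=> t /Dgt0 t0; rewrite /= in_itv/= t0.
apply: open_continuous_measurable_fun => //.
move=> t; rewrite inE/= in_itv/= andbT => t0.
apply: cvgM; first exact: cvg_cst.
apply: cvgB; last exact: cg.
have shift_cvg : (n.+1%:R^-1 + u : R) @[u --> t] --> (n.+1%:R^-1 + t : R).
  by apply: cvgD; [exact: cvg_cst|exact: cvg_id].
by apply: (cvg_comp _ _ shift_cvg); apply: cg; rewrite addr_gt0.
Qed.

(** The positive part [m] of the derivative, set to [0] off the good points, is
    a measurable minorant of [k], hence integrable. By Lebesgue
    differentiation its primitive [F] has derivative [m] almost everywhere, so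
    [g - F] is nonincreasing. As [F] is nondecreasing and bounded, its
    increase, and with it that of [g], is eventually small. *)
Lemma eventually_small_increase (R : realType) (g : R -> R) (k : R -> \bar R)
    (T0 : R) :
  0 <= T0 -> (forall t, 0 < t -> {for t, continuous g}) ->
  (forall a b F, 0 <= a -> {homo F : u v / u <= v} ->
     upper_absolutely_continuous a b (fun t => g t - F t)) ->
  (forall t, 0 <= t -> (0 <= k t)%E) ->
  (\int[lebesgue_measure]_(t in `[0%R, +oo[) k t < +oo)%E ->
  {ae lebesgue_measure, forall t, T0 < t ->
     derivable g t 1 /\ ((derive1 g t)%:E <= k t)%E} ->
  forall e, 0 < e ->
  exists T, forall t1 t2, T <= t1 -> t1 <= t2 -> g t2 - g t1 <= e.
Proof.
move=> T00 cg acg k0 intk [N [mN N0 badN]] e e0.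
pose D := `]T0, +oo[%classic `\` N.
have mD : measurable D by exact: measurableD.
have Dgood t : D t -> derivable g t 1 /\ ((derive1 g t)%:E <= k t)%E.
  move=> [Tt nNt]; apply: contrapT => bad; apply: nNt; apply: badN => good.
  by apply: bad; apply: good; move: Tt; rewrite /= in_itv/= andbT.
have Dgt0 t : D t -> 0 < t.
  by move=> [+ _]; rewrite /= in_itv/= andbT; exact: le_lt_trans.
pose m : R -> R := (derive1 g \max cst 0) \_ D.
have m0 t : 0 <= m t.
  by rewrite /m patchE; case: ifP => // _; rewrite /= le_max lexx orbT.
have mm : measurable_fun setT m.
  have mg' : measurable_fun D (derive1 g : R -> R).
    by apply: measurable_derive1 => // t /Dgood[].
  have mh := measurable_maxr mg' (measurable_cst (0 : R)).
  exact: ((measurable_restrictT _ mD).1 mh).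
have mk t : ((EFin \o m) t <= (k \_ `[0%R, +oo[) t)%E.
  rewrite /= /m !patchE; case: ifPn => [|_].
    rewrite inE => Dt; have [_ gk] := Dgood _ Dt; have t0 := Dgt0 _ Dt.
    rewrite mem_set/= ?in_itv/= ?(ltW t0)// EFin_max ge_max gk/=.
    exact/k0/ltW.
  by case: ifP => //; rewrite inE/= in_itv/= andbT; exact: k0.
have im : lebesgue_measure.-integrable setT (EFin \o m).
  apply/integrableP; split; first exact/measurable_EFinP.
  apply: le_lt_trans intk; apply: ge0_le_integral_nonmeasurable => // t.
    by rewrite /= in_itv/= andbT; exact: k0.
  by rewrite patch_setT /= ger0_norm//; exact: mk.
pose F y : R := (\int[lebesgue_measure]_(t in `]-oo, y]) m t)%R.
have Fm : \forall y \ae lebesgue_measure, derivable F y 1 /\ derive1 F y = m y.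
  apply: FTC1Ny => [y|]; first exact: integrableS im.
  by apply: open_integrable_locally => //; exact: openT.
have Fle y (B : set R) : measurable B -> `]-oo, y] `<=` B ->
    F y <= fine (\int[lebesgue_measure]_(t in B) (m t)%:E)%E.
  move=> mB yB; rewrite /F /Rintegral fine_le//.
  - by apply: integrable_fin_num => //; exact: integrableS im.
  - by apply: integrable_fin_num => //; exact: integrableS im.
  - apply: ge0_subset_integral => //.
    + by apply/measurable_EFinP; exact: measurable_funS mm.
    + by move=> t _; rewrite lee_fin.
have Fhomo : {homo F : u v / u <= v}.
  by move=> u v uv; apply: Fle => // t /=; rewrite !in_itv/= => /le_trans; exact.
have supF : has_sup (range F).
  split; first by exists (F 0), 0.
  by exists (fine (\int[lebesgue_measure]_t (m t)%:E)%E) => _ [y _ <-]; exact: Fle.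
have [_ [T _ <-] supT] := sup_adherent e0 supF.
exists (Num.max T T0) => t1 t2; rewrite ge_max => /andP[Tt1 T0t1] t12.
suff : g t2 - F t2 <= g t1 - F t1.
  have := Fhomo _ _ Tt1.
  have : F t2 <= sup (range F) by apply: ub_le_sup; [case: supF|exists t2].
  by lra.
apply: (@upper_absolutely_continuous_nonincreasing _ t1 t2 (fun t => g t - F t)) => //.
  by apply: acg => //; exact: le_trans T0t1.
have gm : {ae lebesgue_measure, forall t, t1 < t -> derivable g t 1 /\ derive1 g t <= m t}.
  exists N; split=> // t bad; apply: contrapT => nNt; apply: bad => t1t.
  have Dt : D t by split=> //; rewrite /= in_itv/= andbT; exact: le_lt_trans t1t.
  by have [dg _] := Dgood _ Dt; split=> //; rewrite /m patchE mem_set//= le_max lexx.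
apply: (@filterS2 _ _ (ae_filter_ringOfSetsType _) _ _ _ _ gm Fm).
move=> t gt [dF F'] t1t _.
have [dg g'] := gt t1t.
split; first exact: derivableB.
by rewrite derive1E deriveB// -!derive1E F' subr_le0.
Qed.

(** * Dissipation along the trajectory *)

Section trajectories.
Variables (R : realType) (H : normedModType R) (dot : {dot H for idfun}).
Hypothesis dot_norm : forall u : H, dot u u = `|u| ^+ 2.
Variables (Phi Psi : H -> \bar R) (S : set H) (beta : R -> R) (x : R -> H).

(** The subgradient inequalities of [Phi] and [Psi] are tested at [z], where
    both functions are nonpositive, and added with weights [1] and [b]. *)
Lemma subgradient_dissipation (v u p q : H) (b : R) :
  Phi u != -oo%E -> (0 <= Psi u)%E -> 0 <= b ->
  subdifferential dot Phi u p -> subdifferential dot Psi u q ->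
  v + p + b *: q = 0 ->
  exists phi psi, [/\ Phi u = phi%:E, Psi u = psi%:E &
    forall z, (Psi z <= 0)%E -> (Phi z <= 0)%E ->
      dot v (u - z) <= - (phi + b * psi)].
Proof.
move=> Phiu Psiu b0 [Phiy Phip] [Psiy Psiq] vpq.
have [phi Ephi] : exists phi, Phi u = phi%:E.
  by case: (Phi u) Phiu Phiy => // r; exists r.
have [psi Epsi] : exists psi, Psi u = psi%:E.
  by case: (Psi u) Psiu Psiy => // r; exists r.
exists phi, psi; split=> // z Psiz Phiz.
have : phi + dot p (z - u) <= 0.
  by rewrite -lee_fin EFinD -Ephi; exact: le_trans (Phip z) Phiz.
have : psi + dot q (z - u) <= 0.
  by rewrite -lee_fin EFinD -Epsi; exact: le_trans (Psiq z) Psiz.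
have -> : v = - (p + b *: q) by apply/eqP; rewrite -addr_eq0 addrA vpq.
rewrite dotNl dotDl dotZl -(opprB u z) !(dotNr _ (u - z)).
move: (dot p _) (dot q _) => P Q; nra.
Qed.

(** [phi + b * psi] is [b] times the value at [u] of [Psi + b^-1 * Phi], of
    which [omega Psi Phi b^-1] is the infimum. *)
Lemma dissipation_le_omega (u : H) (b phi psi : R) : 0 < b ->
  Phi u = phi%:E -> Psi u = psi%:E ->
  ((- (phi + b * psi))%:E <= b%:E * `|omega Psi Phi b^-1|)%E.
Proof.
move=> b0 Ephi Epsi.
have : (omega Psi Phi b^-1 <= (psi + b^-1 * phi)%:E)%E.
  by apply: ereal_inf_lbound; exists u; rewrite //= Ephi Epsi EFinD EFinM.
case: (omega Psi Phi b^-1) => [r| |]/=; last 2 first.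
- by rewrite leye_eq.
- by move=> _; rewrite gt0_muley ?lte_fin// leey.
rewrite !lee_fin => r_le.
have -> : - (phi + b * psi) = b * - (psi + b^-1 * phi).
  by field; exact: lt0r_neq0.
rewrite ler_pM2l//; apply: (@le_trans _ _ (- r)); first by rewrite lerN2.
by rewrite -normrN ler_norm.
Qed.

Hypothesis x_ac : forall T, 0 <= T -> absolutely_continuous_on 0 T x.
Hypothesis x_dissipates : {ae lebesgue_measure, forall t : R, 0 < t ->
  derivable x t 1 /\ exists phi psi, [/\ Phi (x t) = phi%:E, Psi (x t) = psi%:E &
    forall z, S z -> dot (derive1 x t) (x t - z) <= - (phi + beta t * psi)]}.
Hypothesis beta_cvg : beta t @[t --> +oo] --> +oo.
Hypothesis S_neq0 : S !=set0.

Let energy z t := `|x t - z| ^+ 2 / 2.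

Lemma energy_decrease z t1 t2 B eta e :
  penalized_ge Phi Psi S e eta B ->
  0 <= eta -> S z -> 0 <= t1 -> t1 <= t2 ->
  (forall t, t1 < t -> t < t2 -> B <= beta t /\ e <= dist_set (x t) S) ->
  energy z t2 <= energy z t1 - eta * (t2 - t1).
Proof.
move=> gap eta0 Sz t10 t12 far.
have -> : (energy z t2 <= energy z t1 - eta * (t2 - t1)) =
    (energy z t2 - (- eta * t2) <= energy z t1 - (- eta * t1)).
  by apply/idP/idP; lra.
apply: (upper_absolutely_continuous_nonincreasing
  (k := fun t => energy z t - (- eta * t)) t12).
  apply: half_sqr_dist_upper_absolutely_continuous eta0 _; last by move=> *; lra.
  by apply: absolutely_continuous_onS (x_ac (le_trans t10 t12)).
apply: (@filterS _ _ (ae_filter_ringOfSetsType _)) x_dissipates.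
move=> t diss t1t tt2.
have [dx [phi [psi [Ephi Epsi le]]]] := diss (le_lt_trans t10 t1t).
have [dg gE] := derive_half_sqr_dist dot_norm z dx.
have dl : derivable ( *%R (- eta)) t 1 by [].
split; first exact: derivableB.
rewrite derive1E deriveB// -!derive1E gE.
have -> : derive1 ( *%R (- eta)) t = - eta.
  by rewrite derive1E deriveMl// derive_id mulr1.
have [Bt et] := far _ t1t tt2.
by have := gap _ _ _ _ Bt Ephi Epsi et; have := le _ Sz; lra.
Qed.

Lemma eventually_ge_beta B : exists T, 0 <= T /\ forall t, T < t -> B <= beta t.
Proof.
have /cvgryPge/(_ B)[T [_ hT]] := beta_cvg.
exists (Num.max T 0); split; first by rewrite le_max lexx orbT.
by move=> t; rewrite gt_max => /andP[Tt _]; exact: hT.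
Qed.

(** A trajectory staying at distance [e] from [S] would make an energy
    negative in finite time, so it comes [e]-close to [S] at some [t1]. Suppose
    that it is at distance [2 * e] at a later [t2]. Between the last visit of
    the [e]-neighborhood and [t2] the energies decrease; measured from a point
    [z] of [S] almost nearest at that visit, they keep [x t2] within [2 * e] of
    [z]. *)
Lemma dist_set_trajectory_eventually_lt e :
  (exists eta B : R, 0 < eta /\ penalized_ge Phi Psi S e eta B) ->
  0 < e ->
  exists T, forall t, T <= t -> dist_set (x t) S < 2 * e.
Proof.
move=> [eta [B [eta0 gap]]] e0.
have [T [T0 TB]] := eventually_ge_beta B.
have [t1 Tt1 t1e] : exists2 t1, T < t1 & dist_set (x t1) S < e.
  apply: contrapT => far; have [z Sz] := S_neq0.
  (* At [t2] the bound on the energy would be [- 1]. *)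
  pose t0 := T + 1; pose t2 := t0 + (energy z t0 + 1) / eta.
  have E0 t : 0 <= energy z t by rewrite divr_ge0.
  have d0 : 0 < (energy z t0 + 1) / eta by rewrite divr_gt0// ltr_wpDl.
  have := @energy_decrease z t0 t2 B eta e gap (ltW eta0) Sz.
  have -> : eta * (t2 - t0) = energy z t0 + 1.
    by rewrite /t2 addrAC subrr add0r mulrC divfK// lt0r_neq0.
  suff : ~ (energy z t2 <= energy z t0 - (energy z t0 + 1)).
    move=> contra H1; apply: contra; apply: H1; rewrite /t2 /t0; [lra|lra|].
    move=> t t0t _; have Tt : T < t by lra.
    split; first exact: TB.
    by rewrite leNgt; apply/negP => te; apply: far; exists t.
  by have := E0 t2; lra.
exists t1 => t2 t12; rewrite ltNge; apply/negP => t2e.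
pose A := [set t | [/\ t1 <= t, t <= t2 & dist_set (x t) S <= e]].
have At1 : A t1 by split=> //; exact: ltW.
have At2 : ubound A t2 by move=> t [].
have hA : has_sup A by split; [exists t1|exists t2].
have t1s : t1 <= sup A by apply: ub_le_sup => //; exists t2.
have st2 : sup A <= t2 by apply: ge_sup => //; exists t1.
have t20 : 0 <= t2 by lra.
have e2 : 0 < e / 2 by lra.
have [d d0 small] := absolutely_continuous_on_uniform (x_ac t20) e2.
have [u [t1u ut2 ue] sdu] := sup_adherent d0 hA.
have us : u <= sup A by apply: ub_le_sup; [exists t2|split].
have xs : dist_set (x (sup A)) S < 2 * e.
  apply: (le_lt_trans (dist_set_lipschitz S_neq0 _ (x u))).
  by have := small u (sup A); lra.
have [z Sz sz] := dist_set_lt S_neq0 xs.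
have : energy z t2 <= energy z (sup A) - eta * (t2 - sup A).
  apply: energy_decrease gap (ltW eta0) Sz _ st2 _; first by lra.
  move=> t st tt2; split; first by apply: TB; lra.
  rewrite leNgt; apply/negP => te.
  suff : t <= sup A by lra.
  by apply: ub_le_sup; [exists t2|split; lra].
have : 0 <= eta * (t2 - sup A) by rewrite mulr_ge0 ?(ltW eta0)// subr_ge0.
have := dist_set_le (x t2) Sz; have := normr_ge0 (x (sup A) - z).
rewrite /energy; move: `|x t2 - z| `|x (sup A) - z| sz => p q; nra.
Qed.

End trajectories.

(** * Norm convergence of the trajectory *)

Section strong_convergence.
Variables (R : realType) (H : normedModType R) (dot : {dot H for idfun}).
Hypothesis dot_norm : forall u : H, dot u u = `|u| ^+ 2.
Variables (Phi Psi : H -> \bar R) (S : set H) (x : R -> H).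
Hypotheses (lsc_Phi : lower_semicontinuous Phi)
  (lsc_Psi : lower_semicontinuous Psi).
Hypothesis S_def : forall u, S u <-> (Psi u <= 0)%E /\ (Phi u <= 0)%E.
Hypotheses (S_neq0 : S !=set0) (S_bounded : bounded_set S).
Hypothesis sublevel_precompact : forall r l : R, 0 < r ->
  precompact [set z : H | `|z| <= r /\ (Psi z + Phi z <= l%:E)%E].
Hypothesis x_dist : dist_set (x t) S @[t --> +oo] --> (0 : R).

(** Points [z n] of [S] asymptotically as close to [x] as desired remain in a
    precompact sublevel set; their cluster points belong to [S] by lower
    semicontinuity, and are cluster points of [x]. *)
Lemma trajectory_cluster_point : exists2 z, S z &
  forall e T, 0 < e -> exists2 t, T <= t & `|x t - z| < e.
Proof.
have /choice[w wP] : forall n : nat, exists w : R * H,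
    [/\ n%:R <= w.1, S w.2 & `|x w.1 - w.2| < n.+1%:R^-1].
  move=> n.
  have n0 : 0 < n.+1%:R^-1 :> R by rewrite invr_gt0.
  have /cvgrPdist_lt/(_ _ n0)[M [_ MP]] := x_dist.
  have [|z Sz xz] := @dist_set_lt _ _ _ S_neq0 (x (Num.max (M + 1) n%:R)) (n.+1%:R^-1).
    have Mn : M < Num.max (M + 1) n%:R by rewrite lt_max ltrDl ltr01.
    by have := MP _ Mn; rewrite /= sub0r normrN => /(le_lt_trans (ler_norm _)).
  by exists (Num.max (M + 1) n%:R, z); rewrite /= le_max lexx orbT.
have [M [_ /(_ (`|M| + 1)) SM]] := S_bounded.
have r0 : 0 < `|M| + 1 by rewrite ltr_wpDl.
have wK n : [set z | `|z| <= `|M| + 1 /\ (Psi z + Phi z <= 0%:E)%E] (w n).2.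
  have [_ Sw _] := wP n; have [? ?] := (S_def _).1 Sw; split.
    by apply: SM => //; rewrite (le_lt_trans (ler_norm M))// ltrDl.
  by rewrite -[leRHS]adde0 leeD.
have [z vz] := precompact_sequence_cluster (sublevel_precompact 0 r0) wK.
exists z.
  apply/S_def; split.
    apply: (cluster_le_lsc lsc_Psi vz) => c c0; exists setT; first exact: filterT.
    exists 0%N => n _ _; have [_ /S_def[Pw _] _] := wP n.
    by apply: (le_trans Pw); rewrite lee_fin ltW.
  apply: (cluster_le_lsc lsc_Phi vz) => c c0; exists setT; first exact: filterT.
  exists 0%N => n _ _; have [_ /S_def[_ Pw] _] := wP n.
  by apply: (le_trans Pw); rewrite lee_fin ltW.
move=> e T e0.
have Vz : nbhs z (ball z (e / 2)) by apply: nbhsx_ballx; rewrite divr_gt0.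
have [n] := vz _ Vz (maxn (Num.bound `|T|) (Num.bound (e / 2)^-1)).
rewrite geq_max => /andP[nT ne]; rewrite -ball_normE/= => zw.
have [nw _ xw] := wP n; exists (w n).1.
  apply: le_trans nw; apply: (le_trans (ler_norm T)); apply: ltW.
  by apply: lt_le_trans (archi_boundP (normr_ge0 T)) _; rewrite ler_nat.
rewrite -[x _](subrK (w n).2) -addrA; apply: (le_lt_trans (ler_normD _ _)).
rewrite [ltRHS](splitr e); apply: ltrD; last by rewrite distrC.
apply: (lt_le_trans xw).
rewrite invf_ple ?posrE ?divr_gt0//; apply: ltW.
apply: lt_le_trans (archi_boundP _) _; first by rewrite invr_ge0 divr_ge0 ?ltW.
by rewrite ler_nat (leq_trans ne).
Qed.

Hypothesis x_ac : forall T, 0 <= T -> absolutely_continuous_on 0 T x.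

(** The energy at the cluster point is at most [e ^+ 2 / 8] at some late time
    and increases by at most [e ^+ 2 / 8] afterwards. *)
Lemma trajectory_cvg (k : R -> \bar R) (T0 : R) : 0 <= T0 ->
  (forall t, 0 <= t -> (0 <= k t)%E) ->
  (\int[lebesgue_measure]_(t in `[0%R, +oo[) k t < +oo)%E ->
  {ae lebesgue_measure, forall t, T0 < t -> derivable x t 1 /\
    forall z, S z -> ((dot (derive1 x t) (x t - z))%:E <= k t)%E} ->
  exists2 z, S z & x t @[t --> +oo] --> z.
Proof.
move=> T00 k0 intk aek.
have [z Sz zx] := trajectory_cluster_point; exists z => //.
have cx t : 0 < t -> {for t, continuous x}.
  move=> t0; apply: (@absolutely_continuous_on_continuous _ _ 0 (t + 1)) => //.
    by apply: x_ac; lra.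
  by rewrite ltrDl.
have small_incr : forall e, 0 < e -> exists T, forall t1 t2, T <= t1 -> t1 <= t2 ->
    `|x t2 - z| ^+ 2 / 2 - `|x t1 - z| ^+ 2 / 2 <= e.
  apply: (@eventually_small_increase R (fun t => `|x t - z| ^+ 2 / 2) k T0) => //.
  - move=> t /cx cxt.
    have cn : `|x s - z| @[s --> t] --> `|x t - z|.
      by apply: cvg_norm; apply: cvgB; [exact: cxt|exact: cvg_cst].
    by apply: cvgMl; apply: cvgM.
  - move=> a b F a0 Fhomo.
    apply: (@half_sqr_dist_upper_absolutely_continuous _ _ _ _ _ _ _ 0) => //.
      (* For [b < 0] no interval fits, and every admissible family is empty. *)
      have [b0|b0] := leP 0 b; first exact: absolutely_continuous_onS (x_ac b0).
      move=> e e0; exists 1 => // n l r lr _ _; case: n l r lr => [|n] l r lr.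
        by rewrite big_ord0.
      by have := lr ord0; lra.
    by move=> u v _ uv _; rewrite mul0r subr_le0; exact: Fhomo.
  apply: (@filterS _ _ (ae_filter_ringOfSetsType _)) aek => t xt /xt[dx kx].
  by have [dg ->] := derive_half_sqr_dist dot_norm z dx; split=> //; exact: kx.
apply/cvgrPdist_lt => e e0.
have e4 : 0 < e ^+ 2 / 8 by rewrite divr_gt0// exprn_gt0.
have [T incr] := small_incr _ e4.
have e2 : 0 < e / 2 by lra.
have [t1 Tt1 xt1] := zx _ T e2.
exists t1; split; first exact: num_real.
move=> t /ltW t1t; rewrite distrC.
have := incr _ _ Tt1 t1t.
have := normr_ge0 (x t1 - z); have := normr_ge0 (x t - z).
move: `|x t - z| `|x t1 - z| xt1 => p q; nra.
Qed.

End strong_convergence.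

Theorem corollary3p2 (R : realType) (H : completeNormedModType R)
  (dot : {dot H for idfun})
  (dot_norm : forall u : H, dot u u = `|u| ^+ 2)
  (Psi Phi : H -> \bar R)
  (Psi_ccp : closed_convex_proper Psi)
  (Psi_inf : ereal_inf [set Psi z | z in setT] = 0%E)
  (C_neq0 : argmin setT Psi !=set0)
  (Phi_ccp : closed_convex_proper Phi)
  (Phi_inf : ereal_inf [set Phi z | z in argmin setT Psi] = 0%E)
  (S_neq0 : argmin (argmin setT Psi) Phi !=set0)
  (S_bounded : bounded_set (argmin (argmin setT Psi) Phi))
  (sublevel_precompact : forall r l : R, 0 < r ->
     precompact [set z : H | `|z| <= r /\ (Psi z + Phi z <= l%:E)%E])
  (beta : R -> R)
  (beta_ge0 : forall t : R, 0 <= t -> 0 <= beta t)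
  (beta_cvg : beta t @[t --> +oo] --> +oo)
  (x : R -> H)
  (x_sol : strong_global_solution dot Phi Psi beta x) :
  (dist_set (x t) (argmin (argmin setT Psi) Phi) @[t --> +oo] --> (0 : R)
   /\ (forall xbar : H, argmin (argmin setT Psi) Phi = [set xbar] ->
         x t @[t --> +oo] --> xbar))
  /\ ((\int[lebesgue_measure]_(t in `[0%R, +oo[)
          ((beta t)%:E * `|omega Psi Phi (beta t)^-1|) < +oo)%E ->
      exists2 xoo : H, argmin (argmin setT Psi) Phi xoo &
        weakly_cvg_pinfty dot x xoo).
Proof.
have [[Phi_proper _ Phi_cvx Phi_lsc] [Psi_proper _ Psi_cvx Psi_lsc]] :=
  (Phi_ccp, Psi_ccp).
set S := argmin (argmin setT Psi) Phi in S_neq0 S_bounded *.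
have Psi_ge0 u : (0 <= Psi u)%E.
  by rewrite -Psi_inf; apply: ereal_inf_lbound; exists u.
have Psi_argmin u : argmin setT Psi u <-> (Psi u <= 0)%E.
  split=> [[_ umin]|u0]; last by split=> // v _; exact: le_trans u0 (Psi_ge0 v).
  by rewrite -Psi_inf; apply: le_ereal_inf_tmp => _ [v _ <-]; exact: umin.
have S_def u : S u <-> (Psi u <= 0)%E /\ (Phi u <= 0)%E.
  split=> [[Cu umin]|[/Psi_argmin Cu Phiu]].
    split; first exact/Psi_argmin.
    by rewrite -Phi_inf; apply: le_ereal_inf_tmp => _ [v Cv <-]; exact: umin.
  split=> // v Cv; apply: (le_trans Phiu); rewrite -Phi_inf.
  by apply: ereal_inf_lbound; exists v.
have [x_ac x_incl] := x_sol.
have x_diss : {ae lebesgue_measure, forall t : R, 0 < t ->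
    derivable x t 1 /\ exists phi psi, [/\ Phi (x t) = phi%:E, Psi (x t) = psi%:E &
      forall z, S z -> dot (derive1 x t) (x t - z) <= - (phi + beta t * psi)]}.
  apply: (@filterS _ _ (ae_filter_ringOfSetsType _)) x_incl => t xt t0.
  have [dx [p [q [Phip Psiq pq]]]] := xt t0; split=> //.
  have [phi [psi [Ephi Epsi le]]] := subgradient_dissipation
    (Phi_proper (x t)) (Psi_ge0 (x t)) (beta_ge0 _ (ltW t0)) Phip Psiq pq.
  by exists phi, psi; split=> // z /S_def[Psiz Phiz]; exact: le.
have dist_cvg : dist_set (x t) S @[t --> +oo] --> (0 : R).
  apply/cvgrPdist_lt => e e0; have e2 : 0 < e / 2 by lra.
  have gap := penalized_gap Phi_cvx Psi_cvx Phi_lsc Psi_lsc Phi_proper Psi_ge0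
    S_def S_neq0 S_bounded sublevel_precompact e2.
  have [T xT] := dist_set_trajectory_eventually_lt dot_norm x_ac x_diss beta_cvg
    S_neq0 gap e2.
  exists T; split; first exact: num_real.
  move=> t /ltW /xT; rewrite /= sub0r normrN ger0_norm ?dist_set_ge0//; lra.
split; first split=> //.
  move=> xbar Sxbar; apply/cvgrPdist_lt => e e0.
  have /cvgrPdist_lt/(_ e e0) := dist_cvg.
  apply: filterS => t; rewrite sub0r normrN ger0_norm ?dist_set_ge0//.
  by move=> /(dist_set_lt S_neq0)[z]; rewrite Sxbar => ->; rewrite distrC.
move=> int_omega.
(* Past [T] one may divide by [beta t]. *)
have [T [T0 betaT]] := eventually_ge_beta beta_cvg 1.
have [||z Sz xz] := trajectory_cvg dot_norm Phi_lsc Psi_lsc S_def S_neq0 S_bounded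
  sublevel_precompact dist_cvg x_ac T0 _ int_omega.
- by move=> t t0; rewrite mule_ge0 ?lee_fin ?beta_ge0.
- apply: (@filterS _ _ (ae_filter_ringOfSetsType _)) x_diss => t xt Tt.
  have [dx [phi [psi [Ephi Epsi le]]]] := xt (le_lt_trans T0 Tt); split=> // y Sy.
  apply: le_trans (dissipation_le_omega _ Ephi Epsi).
    by rewrite lee_fin; exact: le.
  by rewrite (lt_le_trans ltr01)// betaT.
- by exists z => // v; exact: cvg_dotl.
Qed.
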